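(* For fixed $n\ge1$, suppose $X^n$ is generated according to $P_{\theta_n}$ with $\theta_n\in\Theta_n$ and choose the uniform prior on $\Theta_n$. For some sequence $a_n$ with $0<a_n<1/2$, let $k_n$ be an integer such that $k_n\ge a_nn$. Then the expected posterior probability of $B_n(\theta_n,k_n)$ is lower bounded as follows: $$P_{\theta_n}\Pi\bigl(B_n(\theta_n,k_n)\bigm|X^n\bigr)\ \ge\ 1-\frac12\Bigl(\frac{e}{a_n}\,\rho(p_n,q_n)^{n/2}\Bigr)^{a_nn}\Bigl(1-\frac{e}{a_n}\,\rho(p_n,q_n)^{n/2}\Bigr)^{-1}.$$
   Context: Stochastic block model with two communities: for $n\ge1$ and $0\le m\le\lfloor n/2\rfloor$ let $\Theta_{n,m}=\{\theta_n\in\{0,1\}^n:\sum_i\theta_{n,i}=m\}$, except that for even $n$ and $m=n/2$, $\Theta_{n,n/2}=\{\theta_n\in\{0,1\}^n:\sum_i\theta_{n,i}=n/2,\ \theta_{n,1}=0\}$. Let $\Theta_n=\bigcup_{m=0}^{\lfloor n/2\rfloor}\Theta_{n,m}$; it has $2^{n-1}$ elements. Let $p_n,q_n\in[0,1]$. Under $P_{\theta_n}$ the observed random graph $X^n=\{X_{ij}:1\le i<j\le n\}\in\mathscr{X}_n=\{0,1\}^{\{(i,j):1\le i<j\le n\}}$ has independent edges with $P_{\theta_n}(X_{ij}=1)=Q_{ij}(\theta_n)$, where $Q_{ij}(\theta_n)=p_n$ if $\theta_{n,i}=\theta_{n,j}$ and $Q_{ij}(\theta_n)=q_n$ if $\theta_{n,i}\ne\theta_{n,j}$.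 Its probability mass function is $p_{\theta_n}(x^n)=\prod_{i<j}Q_{ij}(\theta_n)^{x_{ij}}(1-Q_{ij}(\theta_n))^{1-x_{ij}}$ (with $0^0=1$). The uniform prior gives mass $2^{-(n-1)}$ to each element of $\Theta_n$; the corresponding posterior is $\Pi(A\mid X^n)=\sum_{\theta\in A}p_{\theta}(X^n)\big/\sum_{\theta'\in\Theta_n}p_{\theta'}(X^n)$ for $A\subset\Theta_n$ (defined whenever the denominator is positive, which holds $P_{\theta_n}$-almost surely for each $\theta_n\in\Theta_n$). $P_{\theta_n}f(X^n)$ denotes the expectation of $f(X^n)$ under $P_{\theta_n}$. $\rho(p,q)=p^{1/2}q^{1/2}+(1-p)^{1/2}(1-q)^{1/2}$ is the Hellinger affinity between two Bernoulli distributions with parameters $p$ and $q$. For $\theta_n,\eta_n\in\Theta_n$: $h(\theta_n,\eta_n)=\sum_i|\theta_{n,i}-\eta_{n,i}|$, $k(\theta_n,\eta_n)=\min\{h(\theta_n,\eta_n),\,n-h(\theta_n,\eta_n)\}$, and $B_n(\theta_n,k_n)=\{\eta_n\in\Theta_n:k(\eta_n,\theta_n)\le k_n\}$.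
   Formalization: The formal theorem adds the hypothesis (e/a_n)ρ(p_n,q_n)^{n/2} < 1; without it the bound is undefined when this ratio equals 1 and false when it exceeds 1, since the right-hand side is then greater than 1. *)

(* Defs.v *)
From HB Require Import structures.
From mathcomp Require Import all_boot all_order all_algebra.
From mathcomp Require Import all_classical all_reals all_analysis.

Set Implicit Arguments.
Unset Strict Implicit.
Unset Printing Implicit Defensive.

Import Order.TTheory GRing.Theory Num.Theory.

Local Open Scope ring_scope.

(* Vertices 1, ..., n are represented by 'I_n, i.e. numbered from 0. *)
Definition labelling (n : nat) := {ffun 'I_n -> bool}.

(* When m = n/2, a labelling and its complement lie in the same weight class
   and define the same partition; the class then keeps only the labelling that
   gives label 0 to the first vertex. *)
Definition Theta_m (n m : nat) : {set labelling n} :=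
  [set theta : labelling n | (\sum_(i < n) theta i == m)%N
     && ((m.*2 == n) ==> [forall i : 'I_n, (val i == 0%N) ==> ~~ theta i])].

Definition Theta (n : nat) : {set labelling n} :=
  (\bigcup_(m < n./2.+1) Theta_m n m)%SET.

Definition hamming (n : nat) (theta eta : labelling n) : nat :=
  (\sum_(i < n) `|(theta i : nat) - (eta i : nat)|)%N.

Definition kdist (n : nat) (theta eta : labelling n) : nat :=
  minn (hamming theta eta) (n - hamming theta eta).

Definition Bball (n : nat) (theta : labelling n) (k : int) :
    {set labelling n} :=
  [set eta in Theta n | (kdist eta theta)%:Z <= k].

Definition vpair (n : nat) := {ij : 'I_n * 'I_n | (ij.1 < ij.2)%N}.

Definition graph (n : nat) := {ffun vpair n -> bool}.

Section Model.
Context {R : realType}.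

Definition hellinger_affinity (p q : R) : R :=
  Num.sqrt p * Num.sqrt q + Num.sqrt (1 - p) * Num.sqrt (1 - q).

Variables (n : nat) (p q : R).

Definition edge_prob (theta : labelling n) (i j : 'I_n) : R :=
  if theta i == theta j then p else q.

Definition sbm_pmf (theta : labelling n) (x : graph n) : R :=
  \prod_(e : vpair n)
    (edge_prob theta (val e).1 (val e).2 ^+ x e *
     (1 - edge_prob theta (val e).1 (val e).2) ^+ (1 - x e)%N).

Definition sbm_expectation (theta : labelling n) (f : graph n -> R) : R :=
  \sum_(x : graph n) sbm_pmf theta x * f x.

(* The common prior mass 2^-(n-1) cancels from the ratio.  If the denominator
   vanishes the quotient is 0 by the convention on division; such x have
   mass 0 under every theta in Theta n, so expectations are unaffected. *)
Definition posterior (A : {set labelling n}) (x : graph n) : R :=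
  (\sum_(eta in A) sbm_pmf eta x) / (\sum_(eta in Theta n) sbm_pmf eta x).

End Model.

(* Main.v *)
Require Import Defs.
From HB Require Import structures.
From mathcomp Require Import all_boot all_order all_algebra.
From mathcomp Require Import all_classical all_reals all_analysis.
From mathcomp Require Import ring lra zify.

Set Implicit Arguments.
Unset Strict Implicit.
Unset Printing Implicit Defensive.

Import Order.TTheory GRing.Theory Num.Theory.

Local Open Scope ring_scope.

(** The labellings outside the ball are treated one at a time.  The posterior
    mass of a single [eta] is at most [p_eta / (p_theta + p_eta)], so by the
    arithmetic-geometric mean inequality its expectation under [theta] is at
    most half the Hellinger affinity of [P_theta] and [P_eta]
    ([expected_posterior_point_le]).  This affinity factorizes over the edges:
    an edge contributes 1 if [theta] and [eta] give it the same parameter, and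
    [rho(p, q)] otherwise.  If [D] is the set of vertices on which the two
    labellings differ, the edges of the second kind are those between [D] and
    its complement, so that with [k = kdist eta theta] there are
    [k * (n - k) >= k * n / 2] of them ([sbm_affinity_le]).

    Since [Theta n] contains no two complementary labellings, an element of
    [Theta n] at distance [k] from [theta] is determined by the one of [D],
    [~: D] that has [k] elements, whence at most ['C(n, k)] of them
    ([card_sphere_le]).  For [k >= a * n] this binomial coefficient is at most
    [(e / a) ^+ k] ([binomial_le_expR]), and what remains is the tail of the
    geometric series of ratio [e / a * rho(p, q) `^ (n / 2)]. *)

(** * Labellings and cuts *)

Lemma hammingE n (theta eta : labelling n) :
  hamming theta eta = #|[set i | theta i != eta i]|.
Proof.
rewrite /hamming -sum1_card [RHS]big_mkcond /=; apply: eq_bigr => i _.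
by rewrite inE; case: (theta i); case: (eta i).
Qed.

Lemma kdist_half n (theta eta : labelling n) : ((kdist theta eta).*2 <= n)%N.
Proof. by rewrite /kdist; lia. Qed.

Lemma card_compl n (D : {set 'I_n}) : #|~: D| = (n - #|D|)%N.
Proof. by rewrite [in LHS]cardsCs finset.setCK card_ord. Qed.

Lemma hamming_le n (theta eta : labelling n) : (hamming theta eta <= n)%N.
Proof. by rewrite hammingE -[leqRHS]card_ord max_card. Qed.

Lemma sum_vpair n (F : 'I_n -> 'I_n -> nat) :
  (\sum_(e : vpair n) F (val e).1 (val e).2 =
   \sum_(i < n) \sum_(j < n | i < j) F i j)%N.
Proof.
rewrite pair_big_dep /=.
rewrite (reindex_omap (val : vpair n -> 'I_n * 'I_n) insub) /=; last first.
  by move=> ij lt_ij; rewrite insubT.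
by apply: eq_bigl => e; rewrite (valP e) valK eqxx.
Qed.

(** Orienting each cut edge from [D] to its complement turns the count over
    unordered pairs into the cardinal of [D * ~: D]. *)
Lemma card_cut n (D : {set 'I_n}) :
  #|[set e : vpair n | ((val e).1 \in D) != ((val e).2 \in D)]| =
  (#|D| * (n - #|D|))%N.
Proof.
rewrite -sum1_card big_mkcond /=.
under eq_bigr do rewrite inE.
rewrite (sum_vpair (fun i j => if (i \in D) != (j \in D) then 1 else 0)%N).
rewrite -card_compl -!sum1_card big_distrlr /=.
pose c (i j : 'I_n) := ((i \in D) && (j \notin D) : nat).
transitivity (\sum_(i < n) \sum_(j < n | i < j) (c i j + c j i))%N.
  apply: eq_bigr => i _; apply: eq_bigr => j _.
  by rewrite /c; case: (i \in D); case: (j \in D).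
under [LHS]eq_bigr do rewrite big_split /=.
rewrite [LHS]big_split /= [X in (_ + X)%N](exchange_big_dep xpredT) //=.
rewrite -big_split /=.
rewrite [RHS]big_mkcond /=; apply: eq_bigr => i _.
rewrite [X in (X + _)%N]big_mkcond [X in (_ + X)%N]big_mkcond.
rewrite -big_split /=.
case: ifP => iD; last by rewrite big1 // => j _; rewrite /c iD !if_same.
rewrite [RHS]big_mkcond /=; apply: eq_bigr => j _.
rewrite inE /c iD /=; case: (boolP (j \in D)) => jD /=.
  by rewrite !if_same.
case: ltngtP => // /val_inj eq_ij; by rewrite -eq_ij iD in jD.
Qed.

Lemma weight_compl n (eta eta' : labelling n) :
  (forall i, eta' i = ~~ eta i) ->
  (\sum_(i < n) eta i + \sum_(i < n) eta' i = n)%N.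
Proof.
move=> E; rewrite -big_split /= -[RHS]card_ord -sum1_card.
by apply: eq_bigr => i _; rewrite E; case: (eta i).
Qed.

(** Both weights are at most [n / 2] and they add up to [n], so both labellings
    would lie in the middle class, which fixes the label of the first vertex. *)
Lemma Theta_compl n (eta eta' : labelling n) : (0 < n)%N ->
  eta \in Theta n -> eta' \in Theta n -> ~ (forall i, eta' i = ~~ eta i).
Proof.
move=> n_gt0 /bigcupP[m _]; rewrite inE => /andP[/eqP wm mid].
move=> /bigcupP[m' _]; rewrite inE => /andP[/eqP wm' mid'] E.
have := weight_compl E; rewrite wm wm' => mm'.
have m2 : (m.*2 == n)%N by have := ltn_ord m; have := ltn_ord m'; lia.
have m2' : (m'.*2 == n)%N by have := ltn_ord m; have := ltn_ord m'; lia.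
move: mid mid'; rewrite m2 m2' /=.
move=> /forallP/(_ (Ordinal n_gt0))/= h /forallP/(_ (Ordinal n_gt0))/=.
by rewrite E; case: (eta _) h.
Qed.

(** An element of the sphere is recovered, up to complementation, from the one
    of its two disagreement sets that has [k] elements. *)
Lemma card_sphere_le n (theta : labelling n) (k : nat) : (0 < n)%N ->
  (#|[set eta in Theta n | kdist eta theta == k]| <= 'C(n, k))%N.
Proof.
move=> n_gt0.
pose D (eta : labelling n) := [set i | eta i != theta i].
pose f eta := if #|D eta| == k then D eta else ~: D eta.
set S := [set _ in _ | _].
have f_inj : {in S &, injective f}.
  move=> eta eta'; rewrite !inE => /andP[etaT _] /andP[etaT' _].
  have eqD : D eta = D eta' -> eta = eta'.
    move=> /setP E; apply/ffunP => i; have := E i; rewrite !inE.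
    by case: (eta i); case: (eta' i); case: (theta i).
  have neqD : D eta = ~: D eta' -> eta = eta'.
    move=> /setP E; exfalso; apply: (Theta_compl n_gt0 etaT etaT') => i.
    have := E i; rewrite !inE.
    by case: (eta i); case: (eta' i); case: (theta i).
  rewrite /f; do 2!case: ifP => _ //.
  - by move=> E; apply: neqD; rewrite -E finset.setCK.
  - by move=> /(can_inj (@finset.setCK _)).
rewrite -(card_in_imset f_inj) -[in leqRHS](card_ord n) -card_draws.
apply/subset_leq_card/fintype.subsetP => _ /imsetP[eta + ->].
rewrite !inE /f => /andP[_ /eqP]; rewrite /kdist hammingE -/(D eta) => kE.
case: ifPn => // neq_k; rewrite card_compl.
by move: neq_k kE; rewrite /minn; case: ifP => _ neq_k kE;
  [rewrite kE eqxx in neq_k | rewrite kE].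
Qed.

Section Affinity.
Context {R : realType}.
Implicit Types (p q c d : R).

(** * Hellinger affinity of two block models *)

Lemma hellinger_affinityC c d :
  hellinger_affinity c d = hellinger_affinity d c.
Proof. by rewrite /hellinger_affinity mulrC [X in _ + X]mulrC. Qed.

Lemma hellinger_affinity_refl c : 0 <= c <= 1 -> hellinger_affinity c c = 1.
Proof.
move=> /andP[c0 c1]; rewrite /hellinger_affinity -!expr2 !sqr_sqrtr ?subr_ge0//.
by rewrite subrKC.
Qed.

Lemma hellinger_affinity_ge0 c d : 0 <= hellinger_affinity c d.
Proof. by rewrite addr_ge0 ?mulr_ge0 ?sqrtr_ge0. Qed.

Lemma hellinger_affinity_le1 c d : 0 <= c <= 1 -> 0 <= d <= 1 ->
  hellinger_affinity c d <= 1.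
Proof.
move=> c01 d01; rewrite /hellinger_affinity.
have h := hellinger_affinity_refl c01; have h' := hellinger_affinity_refl d01.
move: h h'; rewrite /hellinger_affinity.
have := sqr_ge0 (Num.sqrt c - Num.sqrt d).
have := sqr_ge0 (Num.sqrt (1 - c) - Num.sqrt (1 - d)).
by lra.
Qed.

Lemma sqrtr_prod (I : finType) (F : I -> R) : (forall i, 0 <= F i) ->
  Num.sqrt (\prod_i F i) = \prod_i Num.sqrt (F i).
Proof.
move=> F0; pose K (x y : R) := 0 <= x /\ Num.sqrt x = y.
suff [] : K (\prod_i F i) (\prod_i Num.sqrt (F i)) by [].
elim/big_rec2: _ => [|i y x _ [x0 <-]]; first by split; rewrite ?sqrtr1.
by split; [exact: mulr_ge0 | rewrite sqrtrM].
Qed.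

Variables (n : nat) (p q : R).
Hypotheses (p01 : 0 <= p <= 1) (q01 : 0 <= q <= 1).
Implicit Types (theta eta : labelling n) (x : graph n).

Lemma edge_prob01 theta i j : 0 <= edge_prob p q theta i j <= 1.
Proof. by rewrite /edge_prob; case: ifP. Qed.

Definition bernoulli_mass c (b : bool) : R := c ^+ b * (1 - c) ^+ (1 - b).

Lemma bernoulli_mass_ge0 c b : 0 <= c <= 1 -> 0 <= bernoulli_mass c b.
Proof. by move=> /andP[c0 c1]; rewrite mulr_ge0 ?exprn_ge0 ?subr_ge0. Qed.

Lemma sbm_pmfE theta x : sbm_pmf p q theta x =
  \prod_(e : vpair n)
    bernoulli_mass (edge_prob p q theta (val e).1 (val e).2) (x e).
Proof. by []. Qed.

Lemma sbm_pmf_ge0 theta x : 0 <= sbm_pmf p q theta x.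
Proof.
by rewrite sbm_pmfE prodr_ge0 // => e _; rewrite bernoulli_mass_ge0 ?edge_prob01.
Qed.

Lemma sum_sbm_pmf theta : \sum_x sbm_pmf p q theta x = 1.
Proof.
under eq_bigr do rewrite sbm_pmfE.
rewrite -(bigA_distr_bigA (fun e : vpair n =>
  bernoulli_mass (edge_prob p q theta (val e).1 (val e).2))) big1 // => e _.
by rewrite big_bool /bernoulli_mass /= expr0 expr1 mulr1 mul1r subrKC.
Qed.

(** The square root of a product measure is a product, and summing it over all
    graphs exchanges sum and product. *)
Lemma sbm_affinity theta eta :
  \sum_x Num.sqrt (sbm_pmf p q theta x) * Num.sqrt (sbm_pmf p q eta x) =
  hellinger_affinity p q ^+ (hamming eta theta * (n - hamming eta theta)).
Proof.
pose Q theta (e : vpair n) := edge_prob p q theta (val e).1 (val e).2.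
pose s e b := Num.sqrt (bernoulli_mass (Q theta e) b) *
              Num.sqrt (bernoulli_mass (Q eta e) b).
transitivity (\sum_(x : graph n) \prod_e s e (x e)).
  apply: eq_bigr => x _; rewrite !sbm_pmfE !sqrtr_prod.
  - by rewrite -big_split.
  - by move=> e; rewrite bernoulli_mass_ge0 ?edge_prob01.
  - by move=> e; rewrite bernoulli_mass_ge0 ?edge_prob01.
rewrite -(bigA_distr_bigA s) hammingE; set D := [set _ | _].
rewrite -card_cut -prodr_const [RHS]big_mkcond /=; apply: eq_bigr => e _.
transitivity (hellinger_affinity (Q theta e) (Q eta e)).
  by rewrite big_bool /s /bernoulli_mass /= !expr0 !expr1 !mulr1 !mul1r.
rewrite !inE /Q /edge_prob.
case: (theta _); case: (theta _); case: (eta _); case: (eta _) => /=;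
  by rewrite ?hellinger_affinity_refl // hellinger_affinityC.
Qed.

(** The exponent [n / 2] per unit of distance is the worst case of [n - k], as
    [k <= n / 2]; a larger exponent gives a smaller power, since [rho <= 1]. *)
Lemma sbm_affinity_le theta eta :
  \sum_x Num.sqrt (sbm_pmf p q theta x) * Num.sqrt (sbm_pmf p q eta x) <=
  (hellinger_affinity p q `^ (n%:R / 2)) ^+ kdist eta theta.
Proof.
rewrite sbm_affinity; set rho := hellinger_affinity p q.
have rho0 : 0 <= rho by exact: hellinger_affinity_ge0.
have rho1 : rho <= 1 by exact: hellinger_affinity_le1.
set h := hamming eta theta; set k := kdist eta theta.
have -> : (h * (n - h) = k * (n - k))%N.
  rewrite /k /kdist -/h; have := hamming_le eta theta; rewrite -/h => hn.
  by rewrite minnE; case: (leqP h (n - h)) => ?; nia.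
have k2 : (k.*2 <= n)%N by exact: kdist_half.
(* Both sides are compared after squaring, which removes the half power. *)
rewrite -ler_sqr ?nnegrE ?exprn_ge0 ?powR_ge0 //.
have -> : (rho `^ (n%:R / 2) ^+ k) ^+ 2 = rho ^+ (n * k).
  rewrite exprAC exprM; congr (_ ^+ k).
  rewrite -[LHS]powR_mulrn ?powR_ge0 // -powRrM divfK ?pnatr_eq0 //.
  by rewrite powR_mulrn.
rewrite -exprM.
by apply: ler_wiXn2l => //; nia.
Qed.

(** * Expected posterior mass of a single labelling *)

(** For [D > 0] this is [2 * sqrt u * sqrt v <= u + v <= D]. *)
Lemma mul_div_le_sqrt (u v D : R) : 0 <= u -> 0 <= v -> u + v <= D ->
  u * (v / D) <= 2^-1 * (Num.sqrt u * Num.sqrt v).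
Proof.
move=> u0 v0 uvD.
have := sqrtr_ge0 u; have := sqrtr_ge0 v.
have := sqr_sqrtr u0; have := sqr_sqrtr v0.
set s := Num.sqrt u; set t := Num.sqrt v => tE sE t0 s0.
have st0 : 0 <= s * t by exact: mulr_ge0.
have [D0|D_neq0] := eqVneq D 0; first by rewrite D0 invr0 !mulr0; lra.
have Dgt0 : 0 < D by rewrite lt_neqAle eq_sym D_neq0 (le_trans _ uvD) ?addr_ge0.
rewrite mulrA ler_pdivrMr // -sE -tE.
have : 2 * (s * t) <= D.
  by apply: le_trans uvD; rewrite -sE -tE; have := sqr_ge0 (s - t); lra.
by nra.
Qed.

(** Among the terms of the evidence, only those of [theta] and [eta] are kept. *)
Lemma expected_posterior_point_le theta eta :
  theta \in Theta n -> eta \in Theta n -> eta != theta ->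
  sbm_expectation p q theta (posterior p q [set eta]) <=
  2^-1 * (hellinger_affinity p q `^ (n%:R / 2)) ^+ kdist eta theta.
Proof.
move=> thetaT etaT neq.
apply: le_trans (ler_wpM2l _ (sbm_affinity_le theta eta)); last first.
  by rewrite invr_ge0.
rewrite mulr_sumr ler_sum // => x _; rewrite /posterior big_set1.
apply: mul_div_le_sqrt; rewrite ?sbm_pmf_ge0 //.
rewrite (bigD1 theta) //= (bigD1 eta) ?etaT //= lerD2l lerDl.
by apply: sumr_ge0 => zeta _; exact: sbm_pmf_ge0.
Qed.

Lemma sbm_expectation_posterior_sum theta (A : {set labelling n}) :
  sbm_expectation p q theta (posterior p q A) =
  \sum_(eta in A) sbm_expectation p q theta (posterior p q [set eta]).
Proof.
rewrite /sbm_expectation exchange_big /=; apply: eq_bigr => x _.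
rewrite -mulr_sumr /posterior mulr_suml.
by under [in RHS]eq_bigr do rewrite big_set1.
Qed.

Lemma expected_posterior_Theta theta : theta \in Theta n ->
  sbm_expectation p q theta (posterior p q (Theta n)) = 1.
Proof.
move=> thetaT; rewrite -(sum_sbm_pmf theta); apply: eq_bigr => x _.
rewrite /posterior; set D := \sum_(_ in _) _.
have [D0|D_neq0] := eqVneq D 0; last by rewrite divff // mulr1.
(* A graph of evidence 0 has mass 0 under each labelling, [theta] included. *)
move/eqP: D0; rewrite psumr_eq0; last by move=> *; exact: sbm_pmf_ge0.
move=> /allP/(_ theta (mem_index_enum _)); rewrite thetaT => /eqP ->.
by rewrite mul0r.
Qed.

End Affinity.

(** * Tail of the sum over the distance *)

Section Tail.
Context {R : realType}.


(** The term of index [k] in the expansion of [(1 + a) ^+ n] is bounded by the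
    whole, hence by [e ^ (a * n)]. *)
Lemma binomial_le_expR (n k : nat) (a : R) : 0 < a -> a * n%:R <= k%:R ->
  'C(n, k)%:R <= (expR 1 / a) ^+ k.
Proof.
move=> a0 ank; have [nk|kn] := ltnP n k.
  by rewrite bin_small // exprn_ge0 // divr_ge0 ?expR_ge0 ?ltW.
rewrite expr_div_n ler_pdivlMr ?exprn_gt0 // -expRM_natl mulr1.
apply: (@le_trans _ _ ((1 + a) ^+ n)).
  rewrite exprDn (bigD1 (inord k)) //= inordK ?ltnS //.
  rewrite expr1n mul1r mulr_natl lerDl sumr_ge0 // => i _.
  by rewrite expr1n mul1r mulrn_wge0 // exprn_ge0 // ltW.
apply: (@le_trans _ _ (expR a ^+ n)).
  by apply: lerXn2r; rewrite ?nnegrE ?expR_ge0 ?expR_ge1Dx // addr_ge0 // ltW.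
by rewrite -expRM_natl ler_expR mulrC.
Qed.

Lemma geometric_tail_le (r : R) (k m : nat) : 0 <= r -> r < 1 ->
  \sum_(k <= j < m) r ^+ j <= r ^+ k / (1 - r).
Proof.
move=> r0 r1; have r1' : 0 < 1 - r by rewrite subr_gt0.
rewrite ler_pdivlMr //; have [mk|/ltnW km] := leqP m k.
  by rewrite big_geq // mul0r exprn_ge0.
rewrite mulr_suml (telescope_sumr_eq (fun j => - r ^+ j)) //.
  by rewrite opprK gerDr oppr_le0 exprn_ge0.
by move=> j _; rewrite exprSr; ring.
Qed.

(** Grouping by distance; the distances from [theta] are less than [n.+1]. *)
Lemma sum_outside_le (n : nat) (theta : labelling n) (K : nat) (a c : R) :
  (0 < n)%N -> 0 < a -> a * n%:R <= K%:R -> 0 <= c ->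
  \sum_(eta in Theta n | (K < kdist eta theta)%N) c ^+ kdist eta theta <=
  \sum_(K.+1 <= j < n.+1) (expR 1 / a * c) ^+ j.
Proof.
move=> n0 a0 aK c0.
rewrite (partition_big (fun eta => inord (kdist eta theta) : 'I_n.+1)
           (fun j => K < j)%N) /=; last first.
  move=> eta /andP[_ ?]; rewrite inordK //.
  by have := kdist_half eta theta; lia.
rewrite big_geq_mkord /=; apply: ler_sum => j Kj.
apply: (@le_trans _ _
  (\sum_(eta in [set eta in Theta n | kdist eta theta == j]) c ^+ j)).
  rewrite le_eqVlt; apply/orP; left; apply/eqP; apply: eq_big => [eta|eta].
    rewrite inE; have := kdist_half eta theta => ?.
    rewrite -val_eqE /= inordK; last by lia.
    by case: eqVneq => [->|_]; rewrite ?andbF ?Kj ?andbT.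
  move=> /andP[_ /eqP <-]; rewrite inordK //.
  by have := kdist_half eta theta; lia.
rewrite sumr_const -[_ *+ _]mulr_natl exprMn ler_wpM2r ?exprn_ge0 //.
apply: (@le_trans _ _ 'C(n, j)%:R); first by rewrite ler_nat card_sphere_le.
apply: binomial_le_expR => //; apply: le_trans aK _.
by rewrite ler_nat ltnW.
Qed.

End Tail.

(** * The posterior mass of the ball *)

Theorem theorem4p4 (R : realType) (n : nat) (p q a : R) (k : int)
    (theta : labelling n)
    (n_ge1 : (1 <= n)%N)
    (p01 : 0 <= p <= 1) (q01 : 0 <= q <= 1)
    (theta_in : theta \in Theta n)
    (a_range : 0 < a < 1 / 2)
    (k_ge : a * n%:R <= k%:~R)
    (ratio_lt1 : expR 1 / a * hellinger_affinity p q `^ (n%:R / 2) < 1) :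
  sbm_expectation p q theta (posterior p q (Bball theta k)) >=
  1 - 1 / 2
      * (expR 1 / a * hellinger_affinity p q `^ (n%:R / 2)) `^ (a * n%:R)
      * (1 - expR 1 / a * hellinger_affinity p q `^ (n%:R / 2))^-1.
Proof.
have /andP[a0 _] := a_range.
have an0 : 0 < a * n%:R by rewrite mulr_gt0 // ltr0n.
case: k k_ge => K k_ge; last first.
  by have := lt_le_trans an0 k_ge; rewrite NegzE ltr0z.
move: k_ge ratio_lt1; set c := _ `^ _; set r := _ * c => aK r1.
have c0 : 0 <= c by exact: powR_ge0.
have r0 : 0 <= r by rewrite mulr_ge0 // divr_ge0 ?expR_ge0 // ltW.
pose out := [set eta in Theta n | (K < kdist eta theta)%N].
have split1 : sbm_expectation p q theta (posterior p q (Bball theta K)) +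
              sbm_expectation p q theta (posterior p q out) = 1.
  rewrite -(expected_posterior_Theta p01 q01 theta_in).
  rewrite !sbm_expectation_posterior_sum.
  rewrite [RHS](bigID (fun eta => (kdist eta theta <= K)%N)) /=.
  by congr (_ + _); apply: eq_bigl => eta; rewrite inE ?lez_nat -?ltnNge.
suff out_le : sbm_expectation p q theta (posterior p q out) <=
    1 / 2 * r `^ (a * n%:R) * (1 - r)^-1 by lra.
rewrite sbm_expectation_posterior_sum.
apply: (@le_trans _ _ (2^-1 * \sum_(eta in out) c ^+ kdist eta theta)).
  rewrite mulr_sumr; apply: ler_sum => eta; rewrite inE => /andP[etaT far].
  apply: expected_posterior_point_le => //; apply: contraL far => /eqP ->.
  (* [theta] is at distance 0 from itself, hence inside the ball. *)
  by rewrite /kdist hammingE eq_card0 ?min0n // => i; rewrite !inE eqxx.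
rewrite div1r -mulrA ler_wpM2l ?invr_ge0 //.
apply: (@le_trans _ _ (r ^+ K.+1 / (1 - r))); last first.
  rewrite ler_wpM2r ?invr_ge0 ?subr_ge0 ?(ltW r1) // -powR_mulrn //.
  have aK1 : a * n%:R <= K.+1%:R by apply: le_trans aK _; rewrite ler_nat.
  have [->|r_neq0] := eqVneq r 0; first by rewrite !powR0 ?gt_eqF // ltr0n.
  by rewrite ger_powR ?(ltW r1) ?andbT // lt_neqAle eq_sym r_neq0.
apply: le_trans (geometric_tail_le _ n.+1 r0 r1).
rewrite (eq_bigl (fun eta => (eta \in Theta n) && (K < kdist eta theta)%N)).
  exact: (sum_outside_le theta n_ge1 a0 aK c0).
by move=> eta; rewrite inE.
Qed.
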